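(* Let $p$ be a prime, $f$ a positive integer and $q=p^f$. Let $h,k$ be nonnegative integers with $h\ge k$ and $f\mid h+k$, and let $r,s$ be positive integers. Then \[ (-1)^{ps}\sum_{b\in\mathbb{Z}} \binom{s\,p^k}{ b(q-1)-r}\equiv (-1)^{pr}\sum_{b\in\mathbb{Z}} \binom{r\,p^h}{ b(q-1)-s} \pmod{p^{k+1}}. \]
   Context: For a nonnegative integer $n$ and an integer $m$, $\binom{n}{m}$ denotes the usual binomial coefficient, with $\binom{n}{m}=0$ when $m<0$ or $m>n$; thus the sums over $b\in\mathbb{Z}$ are finite. *)

(* Defs.v *)
From mathcomp Require Import all_boot all_order all_algebra.
From mathcomp Require Import all_classical.
From mathcomp Require Import zify.

Set Implicit Arguments.
Unset Strict Implicit.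
Unset Printing Implicit Defensive.

Import Order.TTheory GRing.Theory Num.Theory.
Local Open Scope classical_set_scope.
Local Open Scope ring_scope.

Definition binz (n : nat) (m : int) : nat :=
  if m is Posz j then 'C(n, j) else 0%N.

(* A sum over [set: int] is 0 by convention when the support is infinite;
   for q > 1 the sums of [binz n (b * (q%:Z - 1) - r%:Z)] over b avoid it. *)
Lemma binz_finite_support (n r q : nat) : (1 < q)%N ->
  finite_set ([set: int] `&`
    (fun b : int => (binz n (b * (q%:Z - 1) - r%:Z))%:Z) @^-1` [set~ 0]).
Proof.
move=> q_gt1; pose N := (n + r)%N.
apply: (@sub_finite_set _ _ ((fun i : nat => i%:Z - N%:Z) @` `I_(N + N).+1)).
  move=> b [_ /= bin_neq0].
  have [lo hi] : 0 <= b * (q%:Z - 1) - r%:Z /\ b * (q%:Z - 1) - r%:Z <= n%:Z.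
    case: (b * (q%:Z - 1) - r%:Z) bin_neq0 => [j|j] //= bin_neq0; split=> //.
    by rewrite lez_nat leqNgt; apply/negP => lt_nj; rewrite bin_small in bin_neq0.
  exists (absz (b + N%:Z)); rewrite /N /=; nia.
exact/finite_image/finite_II.
Qed.

(* Main.v *)
(* Let F be the field with q elements and T its multiplicative (Teichmuller)
   lift to a ring in which p generates the kernel of reduction to F.  Averaging
   over the (q - 1)-th roots of unity gives
     (q - 1) * sum_b C(n, b(q - 1) - r) = sum_(x != 0) T(x)^r (1 + T(x))^n,
   and, as 1 + T(x) = T(1 + x) mod p, for p^k | n the right-hand side is
   sum_x T(x^r (1 + x)^n) mod p^(k+1).  For n = s p^k, the substitution
   x = (-(1 + y))^(p^h) of F turns this Jacobi sum into the one attached to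
   n = r p^h, up to sign, because x |-> x^(p^(h+k)) is the identity of F.
   The ring is Z[X]/(P), represented by congruences in Z[X] modulo
   (p^(k+1), P). *)
Require Import Defs.
From mathcomp Require Import all_boot all_order all_algebra.
From mathcomp Require Import all_classical.
From mathcomp Require Import all_fingroup all_solvable all_field ring zify.

Set Implicit Arguments.
Unset Strict Implicit.
Unset Printing Implicit Defensive.

Import Order.TTheory GRing.Theory Num.Theory.
Local Open Scope classical_set_scope.
Local Open Scope ring_scope.

(** * Congruences modulo the ideal generated by [p ^ N] and [P] *)

Section Congruences.
Variables (R : comNzRingType) (p : nat) (P : R).

Definition pideal (N : nat) (z : R) : Prop :=
  exists c d : R, z = p%:R ^+ N * c + P * d.

Definition cong (N : nat) (a b : R) : Prop := pideal N (a - b).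

Lemma pidealD N a b : pideal N a -> pideal N b -> pideal N (a + b).
Proof. by move=> [c [d ->]] [c' [d' ->]]; exists (c + c'), (d + d'); ring. Qed.

Lemma pidealMl N a b : pideal N b -> pideal N (a * b).
Proof. by move=> [c [d ->]]; exists (a * c), (a * d); ring. Qed.

Lemma pidealM N M a b : pideal N a -> pideal M b -> pideal (N + M) (a * b).
Proof.
move=> [c [d ->]] [c' [d' ->]].
exists (c * c'), (d * (p%:R ^+ M * c' + P * d') + p%:R ^+ N * c * d').
by rewrite exprD; ring.
Qed.

Lemma pideal_le M N a : (M <= N)%N -> pideal N a -> pideal M a.
Proof.
move=> le_MN [c [d ->]].
by exists (p%:R ^+ (N - M) * c), d; rewrite mulrA -exprD subnKC.
Qed.

Lemma cong_refl N a : cong N a a.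
Proof. by exists 0, 0; ring. Qed.

Lemma cong_sym N a b : cong N a b -> cong N b a.
Proof. by move=> /(pidealMl (-1)); rewrite /cong mulN1r opprB. Qed.

Lemma cong_trans N a b c : cong N a b -> cong N b c -> cong N a c.
Proof. by move=> ab bc; rewrite /cong -[a](subrK b) -addrA; apply: pidealD. Qed.

Lemma cong_le M N a b : (M <= N)%N -> cong N a b -> cong M a b.
Proof. exact: pideal_le. Qed.

Lemma congD N a b c d : cong N a b -> cong N c d -> cong N (a + c) (b + d).
Proof. by move=> ab cd; rewrite /cong opprD addrACA; apply: pidealD. Qed.

Lemma congM N a b c d : cong N a b -> cong N c d -> cong N (a * c) (b * d).
Proof.
move=> /(pidealMl c) ab /(pidealMl b) cd.
by have := pidealD ab cd; rewrite /cong; congr (pideal _ _); ring.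
Qed.

Lemma congX N a b n : cong N a b -> cong N (a ^+ n) (b ^+ n).
Proof.
move=> ab; elim: n => [|n IHn]; first exact: cong_refl.
by rewrite !exprS; apply: congM.
Qed.

Lemma cong_sum N (I : Type) (s : seq I) (Q : pred I) (E G : I -> R) :
  (forall i, Q i -> cong N (E i) (G i)) ->
  cong N (\sum_(i <- s | Q i) E i) (\sum_(i <- s | Q i) G i).
Proof.
move=> EG; elim/big_rec2: _ => [|i y x Qi xy]; first exact: cong_refl.
by apply: congD => //; apply: EG.
Qed.

(* a ^+ p - b ^+ p is a - b times a sum congruent to p * b ^+ p.-1, which
   provides the extra factor p. *)
Lemma congXp N a b : cong N.+1 a b -> cong N.+2 (a ^+ p) (b ^+ p).
Proof.
move=> ab; rewrite /cong subrXX -addn1; apply: pidealM => //.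
suff: cong 1 (\sum_(i < p) a ^+ (p.-1 - i) * b ^+ i) (p%:R * b ^+ p.-1).
  move=> [c [d /(canRL (subrK _)) ->]].
  by exists (c + b ^+ p.-1), d; ring.
have -> : p%:R * b ^+ p.-1 = \sum_(i < p) b ^+ (p.-1 - i) * b ^+ i.
  rewrite (eq_bigr (fun=> b ^+ p.-1)) => [|i _].
    by rewrite sumr_const card_ord mulr_natl.
  by rewrite -exprD subnK // -ltnS (ltn_predK (ltn_ord i)).
apply: cong_sum => i _; apply: congM; last exact: cong_refl.
by apply: congX; apply: cong_le ab.
Qed.

(** Each [p]-th power gains one factor [p], so the class of [a ^+ (p ^ j)] at level [j.+1] depends
    only on [a] modulo [p] and [P]. *)
Lemma congXpn j a b : cong 1 a b -> cong j.+1 (a ^+ (p ^ j)) (b ^+ (p ^ j)).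
Proof.
move=> ab; elim: j => [|j IHj]; first by rewrite expn0 !expr1.
by rewrite expnSr !exprM; apply: congXp.
Qed.

End Congruences.

(** * Generators of finite fields and lacunary binomial sums *)

Lemma finField_generator (F : finFieldType) :
  exists g : F, [/\ g != 0, forall m, g ^+ m = 1 -> (#|F|.-1 %| m)%N
    & forall x, x != 0 -> exists i, x = g ^+ i].
Proof.
have /cyclicP [u u_gen] := field_unit_group_cyclic [set: {unit F}]%G.
exists (FinRing.uval u); split.
- by rewrite -unitfE; apply: (valP u).
- move=> m; rewrite -FinRing.val_unitX => um1.
  rewrite -card_finField_unit u_gen.
  by rewrite -[#|_|]/(#[u]%g) order_dvdn; apply/eqP/val_inj.
move=> x; rewrite -unitfE => Ux.
have : FinRing.unit F Ux \in <[u]>%g by rewrite -u_gen inE.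
by case/cycleP=> i xE; exists i; rewrite -FinRing.val_unitX -xE.
Qed.

(** With [d = q - 1], the indices [j] are those of the form [b * d - r]; writing this as
    divisibility of [r + j] avoids negative numbers. *)
Definition lacunary_sum (d n r : nat) : nat :=
  (\sum_(j < n.+1 | d %| r + j) 'C(n, j))%N.

(** * Teichmuller lifts, power sums and Jacobi sums *)

Section Teichmuller.
Variables (R : comNzRingType) (F : finFieldType) (phi : {rmorphism R -> F}).
Variables (p f : nat) (P : R).
Hypothesis p_prime : prime p.
Hypothesis cardF : #|F| = (p ^ f)%N.
Hypothesis f_gt0 : (0 < f)%N.
Hypothesis phi_surj : forall x, exists a, phi a = x.
Hypothesis phi_ker : forall a, phi a = 0 -> pideal p P 1 a.
Variable k : nat.

Local Notation "a === b" := (cong p P k.+1 a b) (at level 70).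

Definition phi_lift (x : F) : R := xget 0 [set a | phi a = x].

Lemma phi_liftK x : phi (phi_lift x) = x.
Proof.
by have [a ax] := phi_surj x; apply: (@xgetPex _ 0 [set a | phi a = x]); exists a.
Qed.

(** The exponent [f * k] is a multiple of [f], so the power fixes the reduction [x], and is at least
    [k], so the class modulo [p ^ k.+1] and [P] does not depend on the lift chosen. *)
Definition teich (x : F) : R := phi_lift x ^+ (p ^ (f * k)).

Lemma expf_cardX (x : F) n : x ^+ (p ^ (f * n)) = x.
Proof.
elim: n => [|n IHn]; first by rewrite muln0.
by rewrite mulnS expnD exprM -cardF expf_card.
Qed.

Lemma teichK x : phi (teich x) = x.
Proof. by rewrite rmorphXn /= phi_liftK expf_cardX. Qed.

Lemma cong_pow j a b : (k <= j)%N -> phi a = phi b -> a ^+ (p ^ j) === b ^+ (p ^ j).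
Proof.
move=> le_kj ab; apply: (@cong_le _ _ _ _ j.+1) => //; apply: congXpn.
by apply: phi_ker; rewrite rmorphB ab subrr.
Qed.

(** Any lift of [x] computes [teich x]; products and powers of lifts then give multiplicativity. *)
Lemma teich_pow a x : phi a = x -> a ^+ (p ^ (f * k)) === teich x.
Proof. by move=> ax; apply: cong_pow; rewrite ?phi_liftK // leq_pmull. Qed.

Lemma teichM x y : teich (x * y) === teich x * teich y.
Proof.
by apply: cong_sym; rewrite -exprMn; apply: teich_pow; rewrite rmorphM /= !phi_liftK.
Qed.

Lemma teichX x n : teich (x ^+ n) === teich x ^+ n.
Proof.
by apply: cong_sym; rewrite exprAC; apply: teich_pow; rewrite rmorphXn /= phi_liftK.
Qed.

Lemma teich0 : teich 0 === 0.
Proof.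
apply: cong_sym; have := @teich_pow 0 0 (rmorph0 phi).
by rewrite expr0n expn_eq0 -leqn0 leqNgt prime_gt0.
Qed.

Lemma teich1 : teich 1 === 1.
Proof. by apply: cong_sym; have := @teich_pow 1 1 (rmorph1 phi); rewrite expr1n. Qed.

Lemma pcharF_nat n : [pchar F].-nat (p ^ n)%N.
Proof.
by rewrite pnatX (eq_pnat _ (pcharf_eq (card_finPcharP cardF p_prime))) pnat_id.
Qed.

(** The factor [p] in the exponent treats all primes at once: for odd [p] the lift of -1 is -1,
    while for [p = 2] one has -1 = 1 in [F], with lift 1. *)
Lemma teich_sign m : teich ((-1) ^+ m) === (-1) ^+ (p * m).
Proof.
apply: (cong_trans (teichX _ _)); rewrite exprM; apply: congX; apply: cong_sym.
have : phi ((-1) ^+ p) = -1.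
  by rewrite rmorphXn rmorphN1 exprNn_pchar ?expr1n // -[p]expn1 pcharF_nat.
move/teich_pow; rewrite -exprM; congr (cong _ _ _ _ _).
by rewrite -[LHS]signr_odd -[RHS]signr_odd oddM oddX; case: (odd p); rewrite ?orbT.
Qed.

(** If [v] lifts the inverse of [phi u], then [(u * v) ^+ (p ^ k)] is congruent to 1, so [u] is
    invertible modulo the ideal. *)
Lemma cong_cancel u a : phi u != 0 -> u * a === 0 -> a === 0.
Proof.
move=> u_neq0 ua0; have [v phiv] := phi_surj (phi u)^-1.
have : (u * v) ^+ (p ^ k) === 1.
  rewrite -[X in _ === X](expr1n _ (p ^ k)); apply: cong_pow => //.
  by rewrite rmorphM phiv rmorph1 divff.
move/(congM (cong_refl p P k.+1 a)); rewrite mulr1 => /cong_sym/cong_trans; apply.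
rewrite -(prednK (_ : 0 < p ^ k)%N) ?expn_gt0 ?prime_gt0 // exprS.
have := congM (cong_refl p P k.+1 (v * (u * v) ^+ (p ^ k).-1)) ua0.
by rewrite mulr0; congr (cong _ _ _ _ _); ring.
Qed.

(** If [q - 1] divides [m], every term is congruent to 1. Otherwise the substitution of [g * x] for
    [x] multiplies the sum by [teich g ^+ m], and [teich g ^+ m - 1] can be cancelled because its
    reduction is nonzero. *)
Lemma teich_power_sum m :
  \sum_(x : F | x != 0) teich x ^+ m ===
  (if (#|F|.-1 %| m)%N then #|F|.-1 else 0%N)%:R.
Proof.
case: ifP => [/dvdnP [c mE] | /negP ndvd].
  rewrite -(cardC1 (0 : F)) -sumr_const; apply: cong_sum => x x_neq0.
  apply: (cong_trans (cong_sym (teichX _ _))).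
  suff -> : x ^+ m = 1 by apply: teich1.
  rewrite mE mulnC exprM; suff -> : x ^+ #|F|.-1 = 1 by rewrite expr1n.
  apply: (mulIf x_neq0); rewrite -exprSr mul1r prednK ?expf_card //.
  by apply/card_gt0P; exists 0.
have [g [g_neq0 g_ord _]] := finField_generator F.
apply: (@cong_cancel (teich g ^+ m - 1)).
  by rewrite rmorphB rmorphXn rmorph1 /= teichK subr_eq0; apply/eqP => /g_ord.
have : \sum_(x : F | x != 0) teich x ^+ m ===
    teich g ^+ m * \sum_(x : F | x != 0) teich x ^+ m.
  rewrite [X in X === _](reindex (fun x => g * x)) /=; last first.
    exists (fun x => g^-1 * x) => x _; first by rewrite mulKf.
    by rewrite mulVKf.
  rewrite mulr_sumr (eq_bigl (fun x => x != 0)) => [|x]; last first.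
    by rewrite mulf_eq0 (negPf g_neq0).
  apply: cong_sum => x _; rewrite -exprMn; apply: congX; exact: teichM.
move=> /cong_sym; rewrite /cong; congr (pideal _ _ _ _); ring.
Qed.

Lemma lacunary_sum_jacobi r s j : (k <= j)%N -> (0 < r)%N ->
  (#|F|.-1 * lacunary_sum #|F|.-1 (s * p ^ j) r)%:R ===
  \sum_(x : F) teich (x ^+ r * (1 + x) ^+ (s * p ^ j)).
Proof.
move=> le_kj r_gt0; set n := (s * p ^ j)%N.
apply: (@cong_trans _ _ _ _ _
  (\sum_(x : F | x != 0) teich x ^+ r * (1 + teich x) ^+ n)).
  (* After binomial expansion and exchange of sums, the power sum over [x] selects the [i] with
     [q - 1] dividing [r + i]. *)
  rewrite (eq_bigr (fun x => \sum_(i < n.+1) teich x ^+ (r + i) *+ 'C(n, i))) => [|x _].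
    rewrite exchange_big /= big_distrr natr_sum /= big_mkcond /=.
    apply: cong_sum => i _.
    rewrite sumrMnl -[X in _ === X]mulr_natr.
    have -> : (if (#|F|.-1 %| r + i)%N then (#|F|.-1 * 'C(n, i))%:R else 0) =
       (if (#|F|.-1 %| r + i)%N then #|F|.-1 else 0%N)%:R * 'C(n, i)%:R :> R.
      by case: ifP; rewrite ?mul0r // natrM.
    apply: congM; last exact: cong_refl.
    exact: cong_sym (teich_power_sum _).
  rewrite exprDn mulr_sumr; apply: eq_bigr => i _.
  by rewrite expr1n mul1r mulrnAr exprD.
(* The term at [x = 0] is [teich 0], because [r] is positive. *)
rewrite [X in _ === X](bigD1 (0 : F)) //= -[X in X === _]add0r; apply: congD.
  by apply: cong_sym; rewrite expr0n eqn0Ngt r_gt0 mul0r; apply: teich0.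
apply: cong_sum => x _; apply: cong_sym; apply: (cong_trans (teichM _ _)).
apply: congM; first exact: teichX.
apply: (cong_trans (teichX _ _)); rewrite /n mulnC !exprM; apply: congX.
(* Both [teich (1 + x)] and [1 + teich x] reduce to [1 + x], and their [p ^ j]-th powers agree since
   [k <= j]. *)
by apply: cong_pow; rewrite // teichK rmorphD rmorph1 teichK.
Qed.

Lemma lacunary_sum_swap h r s :
  (k <= h)%N -> (f %| h + k)%N -> (0 < r)%N -> (0 < s)%N ->
  (#|F|.-1 * lacunary_sum #|F|.-1 (s * p ^ k) r)%:R ===
  (-1) ^+ (p * (r * p ^ h + s)) * (#|F|.-1 * lacunary_sum #|F|.-1 (r * p ^ h) s)%:R.
Proof.
move=> le_kh /dvdnP [m mE] r_gt0 s_gt0.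
apply: (cong_trans (lacunary_sum_jacobi _ _ r_gt0)) => //.
apply: (@cong_trans _ _ _ _ _ ((-1) ^+ (p * (r * p ^ h + s)) *
    \sum_(x : F) teich (x ^+ s * (1 + x) ^+ (r * p ^ h)))); last first.
  apply: congM; first exact: cong_refl.
  exact: cong_sym (lacunary_sum_jacobi _ _ s_gt0).
have frobD (x y : F) : (x + y) ^+ (p ^ h) = x ^+ (p ^ h) + y ^+ (p ^ h).
  exact: exprDn_pchar (pcharF_nat h).
have frobK (x : F) : (x ^+ (p ^ h)) ^+ (p ^ k) = x.
  by rewrite -exprM -expnD mE mulnC expf_cardX.
have frobKV (x : F) : (x ^+ (p ^ k)) ^+ (p ^ h) = x.
  by rewrite -exprM -expnD addnC mE mulnC expf_cardX.
(* The inverse substitution is [- x ^+ (p ^ k) - 1], because the two Frobenius powers compose to the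
   identity when [f] divides [h + k]. *)
rewrite (reindex (fun x => (- (1 + x)) ^+ (p ^ h))) /=; last first.
  exists (fun x => - x ^+ (p ^ k) - 1) => x _.
    by rewrite frobK; ring.
  have -> : - (1 + (- x ^+ (p ^ k) - 1)) = x ^+ (p ^ k) by ring.
  by rewrite frobKV.
rewrite mulr_sumr; apply: cong_sum => x _.
have -> : 1 + (- (1 + x)) ^+ (p ^ h) = (- x) ^+ (p ^ h).
  by rewrite -{1}(expr1n _ (p ^ h)) -frobD; congr (_ ^+ _); ring.
(* The argument of [teich] is now the product of [(- (1 + x)) ^+ (r * p ^ h)] and [(- x) ^+ s];
   collecting the signs leaves the other Jacobi sum. *)
rewrite (mulnC s) (exprM _ (p ^ k)%N s) frobK -exprM (mulnC (p ^ h)%N).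
rewrite -(mulN1r (1 + x)) -(mulN1r x) !exprMn mulrACA -exprD.
rewrite (mulrC ((1 + x) ^+ _)).
apply: (cong_trans (teichM _ _)); apply: congM; last exact: cong_refl.
exact: teich_sign.
Qed.
End Teichmuller.

(** * A model of the lifted ring over the integers *)

(* P is a monic integer polynomial of least degree vanishing at a generator g
   of the multiplicative group of F.  If a has smaller degree and vanishes at
   g, then p divides its leading coefficient, for otherwise a Bezout relation
   with p would make a combination of a and p * 'X^(deg a) monic. *)
Lemma integer_model (F : finFieldType) (p : nat) : p \in [pchar F] ->
  exists (phi : {rmorphism {poly int} -> F}) (P : {poly int}),
  [/\ forall x, exists a, phi a = x,
      forall a, phi a = 0 -> pideal p P 1 a
    & forall N (z : int), pideal p P N z%:P -> (p%:Z ^+ N %| z)%Z].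
Proof.
move=> pF; have p_prime : prime p by case/andP: pF.
have [g [g_neq0 _ g_gen]] := finField_generator F.
pose phi : {rmorphism {poly int} -> F} :=
  horner_eval g \o map_poly (intr : int -> F).
have phiC z : phi z%:P = z%:~R by rewrite /phi /= map_polyC /horner_eval hornerC.
have phiXn n : phi 'X^n = g ^+ n by rewrite /phi /= map_polyXn /horner_eval hornerXn.
have [n [[P [Pmonic phiP Psize]] Pmin]] : exists n,
    (exists P : {poly int}, [/\ P \is monic, phi P = 0 & size P = n])
    /\ forall Q : {poly int}, Q \is monic -> phi Q = 0 -> (n <= size Q)%N.
  pose A n := `[< exists P : {poly int}, [/\ P \is monic, phi P = 0 & size P = n] >].
  have exA : exists n, A n.
    (* A monic polynomial vanishing at [g] exists, by Fermat's identity in [F]. *)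
    exists (size ('X^(#|F|.-1) - 1 : {poly int})); apply/asboolP.
    exists ('X^(#|F|.-1) - 1).
    have cardF1 : (1 < #|F|)%N by apply: card_finRing_gt1.
    split=> //; first by apply: monicXnsubC; rewrite -ltnS prednK // ltnW.
    rewrite rmorphB rmorph1 phiXn; apply/eqP; rewrite subr_eq0; apply/eqP.
    by apply: (mulIf g_neq0); rewrite -exprSr mul1r prednK ?expf_card // ltnW.
  case: (ex_minnP exA) => n /asboolP An nmin; exists n; split=> // Q Qm phiQ.
  by apply: nmin; apply/asboolP; exists Q.
exists phi, P; split.
- move=> x; have [->|/g_gen [i ->]] := eqVneq x 0.
    by exists 0; rewrite rmorph0.
  by exists 'X^i.
(* Below the degree of [P] the kernel is generated by [p]: the leading terms are removed one by one.
   The general case follows by division by [P]. *)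
- have small m (a : {poly int}) : (size a <= m)%N -> (m < n)%N -> phi a = 0 ->
      pideal p P 1 a.
    elim: m a => [|m IHm] a size_a lt_mn phia.
      exists 0, 0; move: size_a; rewrite leqn0 size_poly_eq0 => /eqP ->; ring.
    have aE : a = take_poly m a + a`_m *: 'X^m.
      apply/polyP => i; rewrite coefD coef_take_poly coefZ coefXn.
      case: ltngtP => [||->]; rewrite ?mulr0 ?addr0 ?mulr1 ?add0r // => lt_mi.
      by rewrite nth_default // (leq_trans size_a).
    have phiM : phi (a`_m *: 'X^m) = (a`_m)%:~R * g ^+ m.
      by rewrite -mul_polyC rmorphM phiC phiXn.
    have [/dvdzP [c cE]|ndvd] := boolP (p%:Z %| a`_m)%Z.
      have phi0 : phi (a`_m *: 'X^m) = 0.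
        by rewrite phiM cE intrM -[p%:Z%:~R]/(p%:R) (pcharf0 pF) mulr0 mul0r.
      rewrite aE; apply: pidealD.
        apply: IHm; [exact: size_take_poly | exact: ltnW |].
        by move: phia; rewrite {1}aE rmorphD phi0 addr0.
      exists (c *: 'X^m), 0; rewrite mulr0 addr0 expr1 cE.
      by rewrite mulrC -scalerA -[p%:Z]natz scaler_nat mulr_natl.
    exfalso.
    have cop : coprimez p%:Z a`_m by rewrite coprimezE /= prime_coprime // -dvdzE.
    case: (Bezoutz p%:Z a`_m) => u [v]; rewrite (eqP cop : gcdz _ _ = 1) => uvE.
    pose Q := v *: a + (u * p%:Z) *: 'X^m.
    have QE : Q = v *: take_poly m a + 'X^m.
      rewrite /Q {1}aE scalerDr -addrA scalerA -scalerDl.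
      by rewrite [v * _ + _]addrC uvE scale1r.
    have size_lt : (size (v *: take_poly m a) < size ('X^m : {poly int}))%N.
      by rewrite size_polyXn ltnS (leq_trans (size_scale_leq _ _)) ?size_take_poly.
    have Qmonic : Q \is monic by rewrite QE monicE lead_coefDr // lead_coefXn.
    have size_Q : size Q = m.+1 by rewrite QE addrC size_polyDl // size_polyXn.
    suff /(Pmin Q Qmonic) : phi Q = 0 by rewrite size_Q leqNgt lt_mn.
    rewrite /Q rmorphD -!mul_polyC !rmorphM phia mulr0 add0r !phiC.
    by rewrite -[p%:Z%:~R]/(p%:R) (pcharf0 pF) mulr0 mul0r.
  move=> a phia; have P_neq0 := monic_neq0 Pmonic.
  have aE := Pdiv.RingMonic.rdivp_eq Pmonic a.
  rewrite aE; apply: pidealD.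
    by exists 0, (Pdiv.CommonRing.rdivp a P); rewrite mulr0 add0r mulrC.
  apply: (small n.-1).
  - rewrite -ltnS (ltn_predK (_ : 0 < n)%N) -Psize ?size_poly_gt0 //.
    by rewrite Pdiv.CommonRing.ltn_rmodp.
  - by rewrite prednK // -Psize size_poly_gt0.
  by move: phia; rewrite {1}aE rmorphD rmorphM phiP mulr0 add0r.
(* A constant is its own remainder modulo the nonconstant monic [P], so [z] is [p ^ N] times the
   remainder of [c]; the constant coefficients give the divisibility. *)
move=> N z [c [d zE]].
have size_P : (1 < size P)%N.
  rewrite ltnNge; apply/negP => /size1_polyC PE.
  have P1 : P = 1.
    by move: Pmonic; rewrite PE monicE lead_coefC => /eqP ->.
  by move: phiP; rewrite P1 rmorph1 => /eqP; rewrite oner_eq0.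
have : Pdiv.CommonRing.rmodp z%:P P = z%:P.
  by rewrite Pdiv.CommonRing.rmodp_small // (leq_ltn_trans (size_polyC_leq1 _)).
have zE' : z%:P = (p%:Z ^+ N) *: c + d * P.
  by rewrite zE -mul_polyC rmorphXn /= -[p%:Z]natz polyC_natr [P * d]mulrC.
rewrite {1}zE' Pdiv.RingMonic.rmodpD // Pdiv.RingMonic.rmodp_mull // addr0.
rewrite Pdiv.RingMonic.rmodpZ // => /(congr1 (fun u : {poly int} => u`_0)).
by rewrite coefZ coefC /= => <-; apply: dvdz_mulr.
Qed.

(** * From sums over all integers to lacunary sums, and the congruence over the integers *)

Lemma fsbig_lacunary (q n r : nat) : (1 < q)%N ->
  \sum_(b \in [set: int]) (binz n (b * (q%:Z - 1) - r%:Z))%:Z =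
  (lacunary_sum q.-1 n r)%:Z.
Proof.
move=> q_gt1; have q1_gt0 : (0 < q.-1)%N by rewrite -subn1 subn_gt0.
pose js := [seq j <- iota 0 n.+1 | (q.-1 %| r + j)%N].
(* The unique [b] with [b * (q - 1) - r = j]; the images of [js] carry the whole support. *)
pose b_of (j : nat) : int := ((r + j) %/ q.-1)%N%:Z.
have b_ofE j : j \in js -> b_of j * (q%:Z - 1) - r%:Z = j%:Z.
  rewrite mem_filter => /andP[/divnK jE _].
  have -> : q%:Z - 1 = q.-1%:Z by lia.
  by rewrite /b_of -PoszM jE PoszD; ring.
rewrite (@fsbigE _ _ _ _ _ (map b_of js)) //.
- rewrite big_map (eq_bigl xpredT) => [|j]; last by rewrite in_setT.
  rewrite big_seq (eq_bigr (fun j => 'C(n, j)%:Z)) => [|j j_js]; last first.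
    by rewrite b_ofE.
  rewrite -big_seq /js big_filter -[iota 0 n.+1]/(index_iota 0 n.+1) big_mkord.
  by rewrite (big_morph Posz PoszD (erefl _)).
- rewrite map_inj_in_uniq ?filter_uniq ?iota_uniq // => i j i_js j_js ij.
  by have := b_ofE i i_js; rewrite ij b_ofE // => -[].
(* A nonzero term forces [b * (q - 1) - r] to be some [j] with [0 <= j <= n], hence [b = b_of j]. *)
move=> b _; apply: contraNeq => bin_neq0.
have [j jE] : exists j, b * (q%:Z - 1) - r%:Z = Posz j.
  by case: (b * (q%:Z - 1) - r%:Z) bin_neq0 => [j|j] //; exists j.
rewrite jE /= in bin_neq0.
have le_jn : (j <= n)%N.
  by rewrite leqNgt; apply/negP => lt_nj; rewrite bin_small in bin_neq0.
have rjE : (r + j)%N%:Z = b * q.-1%:Z by lia.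
have b_ge0 : 0 <= b by nia.
case: b b_ge0 jE rjE {bin_neq0} => // m _ jE /eqP.
rewrite -PoszM eqz_nat => /eqP rjE.
apply/mapP; exists j; last by rewrite /b_of rjE mulnK.
by rewrite mem_filter rjE dvdn_mull // mem_iota.
Qed.

Unset Implicit Arguments.

Theorem theorem1p2 (p f q h k r s : nat)
    (p_prime : prime p) (f_gt0 : (0 < f)%N) (q_def : q = (p ^ f)%N)
    (le_kh : (k <= h)%N) (f_dvd : (f %| h + k)%N)
    (r_gt0 : (0 < r)%N) (s_gt0 : (0 < s)%N) :
  ((-1) ^+ (p * s) *
     (\sum_(b \in [set: int])
        (binz (s * p ^ k) (b * (q%:Z - 1) - r%:Z))%:Z)
   = (-1) ^+ (p * r) *
     (\sum_(b \in [set: int])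
        (binz (r * p ^ h) (b * (q%:Z - 1) - s%:Z))%:Z)
   %[mod (p ^ k.+1)%N%:Z])%Z.
Proof.
have [F _ cardF] := pPrimePowerField p_prime f_gt0.
have [phi [P [surj ker detect]]] := integer_model (card_finPcharP cardF p_prime).
have q_gt1 : (1 < q)%N by rewrite q_def -{1}(expn0 p) ltn_exp2l ?prime_gt1.
rewrite !fsbig_lacunary //.
have := lacunary_sum_swap p_prime cardF f_gt0 surj ker le_kh f_dvd r_gt0 s_gt0.
rewrite cardF -q_def; set A := lacunary_sum _ _ r; set B := lacunary_sum _ _ s.
set e := (p * (_ + s))%N => AB.
(* Both sides are constant polynomials, so the congruence descends to the integers. *)
have {AB}/detect dvdAB :
    pideal p P k.+1 ((q.-1 * A)%:Z - (-1) ^+ e * (q.-1 * B)%:Z)%:P.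
  move: AB; rewrite /cong; congr (pideal _ _ _ _).
  rewrite polyCB polyCM polyC_exp polyCN -[(q.-1 * A)%N%:Z]natz.
  by rewrite -[(q.-1 * B)%N%:Z]natz !polyC_natr.
apply/eqP; rewrite eqz_mod_dvd.
(* Only parity matters: [p * s] occurs twice, and [p * (r * p ^ h)] has the parity of [p * r]. *)
have eE : (-1) ^+ (p * s) * (-1) ^+ e = (-1) ^+ (p * r) :> int.
  rewrite -exprD -signr_odd -[RHS]signr_odd /e oddD !oddM oddD oddM oddX.
  by case: (odd p) (odd r) (odd s) => [] [] [] //=; rewrite ?orbT.
(* The factor [q - 1] left by averaging over the roots of unity is prime to [p] and can be
   cancelled. *)
have cop : coprimez (p ^ k.+1)%N%:Z q.-1%:Z.
  rewrite coprimezE /= coprimeXl // prime_coprime //.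
  apply/negP => p_q1; have p_q : (p %| q.-1 + 1)%N.
    by rewrite addn1 prednK ?q_def ?dvdn_exp // -q_def ltnW.
  by move: p_q; rewrite dvdn_addr // dvdn1 => /eqP p1; rewrite p1 in p_prime.
rewrite -(Gauss_dvdzr _ cop).
have -> : q.-1%:Z * ((-1) ^+ (p * s) * A%:Z - (-1) ^+ (p * r) * B%:Z) =
  (-1) ^+ (p * s) * ((q.-1 * A)%:Z - (-1) ^+ e * (q.-1 * B)%:Z).
  by rewrite -eE !PoszM; ring.
by apply: dvdz_mull; rewrite -rmorphXn in dvdAB.
Qed.
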